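(* Let $\mathbb{F}$ be a finite field, let $V$ be a finite-dimensional vector space over $\mathbb{F}$, let $d \ge 1$, and let $T, S : V^d \to \mathbb{F}$ be order-$d$ tensors. Then $$\mathrm{arank}(T+S) \le \mathrm{arank}(T) + \mathrm{arank}(S).$$
   Context: An order-$d$ tensor is a multilinear map $T : V^d \to \mathbb{F}$ (linear in each of its $d$ arguments separately). Fix a nontrivial additive character $\chi : \mathbb{F} \to \mathbb{C}$. For a function $F : X \to \mathbb{F}$ on a finite nonempty set $X$, its bias is $\mathrm{bias}(F) = \mathbb{E}_{x \in X}[\chi(F(x))]$, the expectation being over uniform $x \in X$. For an order-$d$ tensor $T$ with $d \ge 1$, $\mathrm{bias}(T)$ (taken with $X = V^d$) is real and equals $\Pr_{x^2,\ldots,x^d \in V}[T(\cdot, x^2, \ldots, x^d) \equiv 0]$; in particular it lies in $[0,1]$. The analytic rank of $T$ is $\mathrm{arank}(T) = -\log_{|\mathbb{F}|} \mathrm{bias}(T)$, with the convention $\mathrm{arank}(T) = +\infty$ if $\mathrm{bias}(T) = 0$ (which can occur only when $d=1$). *)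

(* Defs.v *)
From mathcomp Require Import all_boot all_order all_algebra all_field.
From mathcomp Require Import complex.
From mathcomp Require Import reals ereal exp.

Set Implicit Arguments.
Unset Strict Implicit.
Unset Printing Implicit Defensive.

Import Order.TTheory GRing.Theory Num.Theory.

Local Open Scope ring_scope.
Local Open Scope complex_scope.

(* [V ^ d] is {ffun 'I_d -> V}, the d-fold product of V. *)
Definition multilinear (F : fieldType) (V : lmodType F) (d : nat)
    (T : (V ^ d)%type -> F) : Prop :=
  forall (i : 'I_d) (x : (V ^ d)%type),
    scalar (fun v : V => T (finfun [eta x with i |-> v])).

Definition additive_character (F : finFieldType) (R : realType)
    (chi : F -> R[i]) : Prop :=
  chi 0 = 1 /\ {morph chi : a b / a + b >-> a * b}.

Definition nontrivial_character (F : finFieldType) (R : realType)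
    (chi : F -> R[i]) : Prop :=
  exists a : F, chi a != 1.

Definition bias (F : finFieldType) (R : realType) (chi : F -> R[i])
    (X : finType) (f : X -> F) : R[i] :=
  (\sum_(x : X) chi (f x)) / #|X|%:R.

(* The bias of a tensor of order at least 1 is a nonnegative real, so taking
   its real part only changes the type from R[i] to R.  The alias
   [finvect_type V] of V carries the finType structure that a vector space
   over a finite field has. *)
Definition arank (F : finFieldType) (R : realType) (chi : F -> R[i])
    (V : vectType F) (d : nat) (T : (finvect_type V ^ d)%type -> F) : \bar R :=
  if bias chi T == 0 then +oo%E
  else (- (ln (complex.Re (bias chi T)) / ln (#|F|%:R)))%:E.

(* Main.v *)
Require Import Defs.
From mathcomp Require Import all_boot all_order all_algebra all_field.
From mathcomp Require Import complex.
From mathcomp Require Import reals ereal exp.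

Import Order.TTheory GRing.Theory Num.Theory.

Local Open Scope ring_scope.
Local Open Scope complex_scope.

(** Put y = x + z in bias(T) bias(S) = E_{x,y} chi(T(x) + S(y)).  For fixed z,
    the function T(x) + S(x + z) is affine in each coordinate of x.  Summing
    first over one coordinate, the sum of a character over an affine function
    has modulus at most its sum over the linear part, which is nonnegative; so
    discarding that coordinate of z can only increase the modulus of the sum.
    Once all coordinates of z are gone, E_x chi(T(x) + S(x + z)) is bounded by
    bias(T + S), whence bias(T) bias(S) <= bias(T + S). *)

Section CharacterSums.

Context {A : finZmodType} {C : numFieldType} (chi : A -> C).
Hypotheses (chi0 : chi 0 = 1) (chiD : {morph chi : a b / a + b >-> a * b}).

(** Translating by [a] permutes [A], so the product of all values of [chi] is unchanged when
    multiplied by [chi a ^+ #|A|]. Hence [chi a] is a root of unity. *)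
Lemma norm_char (a : A) : `|chi a| = 1.
Proof.
have card_gt0 : (0 < #|A|)%N by apply/card_gt0P; exists 0.
have chi_neq0 b : chi b != 0.
  apply/eqP=> chib0; have := chiD b (- b).
  by rewrite subrr chi0 chib0 mul0r => /eqP; rewrite oner_eq0.
have chiX : chi a ^+ #|A| = 1.
  have prod_neq0 : \prod_b chi b != 0 by apply/prodf_neq0.
  apply: (mulIf prod_neq0); rewrite mul1r [RHS](reindex_inj (addrI a)) /=.
  by rewrite -prodr_const -big_split; apply: eq_bigr => b _; rewrite chiD.
by apply/eqP; rewrite -(pexpr_eq1 card_gt0) // -normrX chiX normr1.
Qed.

Context {V : finZmodType}.

Lemma mul_char_sum (l : V -> A) (w : V) : {morph l : a b / a + b} ->
  chi (l w) * \sum_v chi (l v) = \sum_v chi (l v).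
Proof.
move=> lD; rewrite mulr_sumr [RHS](reindex_inj (addrI w)) /=.
by apply: eq_bigr => v _; rewrite lD chiD.
Qed.

(** By translation invariance, a nonzero sum can absorb the factor [chi (l w)] only if that factor
    is 1. The sum is therefore 0 or [#|V|]. *)
Lemma char_sum_ge0 (l : V -> A) : {morph l : a b / a + b} ->
  0 <= \sum_v chi (l v).
Proof.
move=> lD; have [->//|sum_neq0] := eqVneq (\sum_v chi (l v)) 0.
apply: sumr_ge0 => w _; suff -> : chi (l w) = 1 by exact: ler01.
by apply: (mulIf sum_neq0); rewrite mul_char_sum // mul1r.
Qed.

Context {d : nat}.
Implicit Types (x z : {ffun 'I_d -> V}) (f g h : {ffun 'I_d -> V} -> A).

Definition upd x (i : 'I_d) (v : V) : {ffun 'I_d -> V} :=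
  finfun [eta x with i |-> v].

Lemma updE x i v j : upd x i v j = if j == i then v else x j.
Proof. by rewrite ffunE. Qed.

Definition additive_in f (i : 'I_d) : Prop :=
  forall x, {morph (fun v => f (upd x i v)) : a b / a + b}.

Lemma additive_inD f g i :
  additive_in f i -> additive_in g i -> additive_in (f \+ g) i.
Proof. by move=> fD gD x a b /=; rewrite fD gD addrACA. Qed.

(** Instead of splitting off coordinate [i], the sum is averaged over all translations along it.
    Each line in direction [i] is then met once per point on it, which accounts for the factor
    [#|V|]. *)
Lemma char_sum_fiber g h i : additive_in g i ->
    (forall x v, h (upd x i v) = h x) ->
  #|V|%:R * \sum_x chi (g x + h x)
    = \sum_x chi (h x) * \sum_v chi (g (upd x i v)).
Proof.
move=> gD h_const; pose e v := upd 0 i v.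
have addE x v : x + e v = upd x i (x i + v).
  by apply/ffunP=> j; rewrite updE ffunE updE ffunE; case: eqP => [->|]; rewrite ?addr0.
have updK x : upd x i (x i) = x.
  by apply/ffunP=> j; rewrite updE; case: eqP => // ->.
rewrite mulr_natl -sumr_const.
transitivity (\sum_v \sum_(x : {ffun 'I_d -> V}) chi (g (x + e v) + h (x + e v))).
  by apply: eq_bigr => v _; rewrite (reindex_inj (addIr (e v))).
rewrite exchange_big; apply: eq_bigr => x _ /=.
(* The inner sum absorbs a factor [chi (g x)], which supplies the [x i] part of [g] at [x i + v]. *)
rewrite -(mul_char_sum _ (x i) (gD x)) !mulr_sumr; apply: eq_bigr => v _.
by rewrite addE gD h_const !chiD updK [RHS]mulrC.
Qed.

Let card_gt0 : 0 < #|V|%:R :> C.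
Proof. by rewrite ltr0n; apply/card_gt0P; exists 0. Qed.

Lemma char_sum_additive g i : additive_in g i ->
  #|V|%:R * \sum_x chi (g x) = \sum_x \sum_v chi (g (upd x i v)).
Proof.
move=> gD; have := @char_sum_fiber g (fun=> 0) i gD (fun _ _ => erefl).
under eq_bigr do rewrite addr0.
by under [in RHS]eq_bigr do rewrite chi0 mul1r.
Qed.

Lemma char_sum_additive_ge0 g i : additive_in g i -> 0 <= \sum_x chi (g x).
Proof.
move=> gD; rewrite -(pmulr_rge0 _ card_gt0) (char_sum_additive _ _ gD).
by apply: sumr_ge0 => x _; apply: char_sum_ge0.
Qed.

(** Each fiber contributes a number [chi (h x)] of modulus 1 times a nonnegative sum. *)
Lemma char_sum_affine_le g h i : additive_in g i ->
    (forall x v, h (upd x i v) = h x) ->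
  `|\sum_x chi (g x + h x)| <= \sum_x chi (g x).
Proof.
move=> gD h_const; rewrite -(ler_pM2l card_gt0) -{1}(gtr0_norm card_gt0).
rewrite -normrM (char_sum_fiber _ _ _ gD h_const) (char_sum_additive _ _ gD).
apply: le_trans (ler_norm_sum _ _ _) _; apply: ler_sum => x _.
by rewrite normrM norm_char mul1r ger0_norm // char_sum_ge0.
Qed.

Definition drop_coords (k : nat) z : {ffun 'I_d -> V} :=
  [ffun j : 'I_d => if (k <= j)%N then z j else 0].

(** Additivity in coordinate [k], where the shifted point has entry [x k + z k], splits [g] in two.
    The [x k] part joins [f] as the linear part. The [z k] part does not depend on [x k] and is the
    constant term of the affine bound. *)
Lemma char_sum_shift_step f g (k : 'I_d) z :
    additive_in f k -> additive_in g k ->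
  `|\sum_x chi (f x + g (x + drop_coords k z))|
    <= \sum_x chi (f x + g (x + drop_coords k.+1 z)).
Proof.
move=> fD gD.
have updD x v : upd x k v + drop_coords k.+1 z
              = upd (x + drop_coords k.+1 z) k v.
  apply/ffunP=> j; rewrite ffunE !updE !ffunE.
  by case: eqP => // ->; rewrite ltnn addr0.
have splitE x : g (x + drop_coords k z) = g (x + drop_coords k.+1 z)
                + g (upd (x + drop_coords k z) k (z k)).
  have -> : x + drop_coords k z = upd (x + drop_coords k z) k (x k + z k).
    apply/ffunP=> j; rewrite updE !ffunE.
    by case: eqP => // ->; rewrite leqnn.
  rewrite gD; congr (g _ + g _).
    apply/ffunP=> j; rewrite updE !ffunE.
    have [->|neq_jk] := eqVneq j k; first by rewrite ltnn addr0.
    by rewrite [(k < j)%N]ltn_neqAle (inj_eq val_inj) eq_sym neq_jk.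
  by apply/ffunP=> j; rewrite !updE; case: eqP.
under eq_bigr do rewrite splitE addrA.
apply: (@char_sum_affine_le _ (fun x => g (upd (x + drop_coords k z) k (z k))) k).
  by apply: additive_inD fD _ => x a b; rewrite !updD gD.
move=> x v; congr (g _); apply/ffunP=> j; rewrite !updE !ffunE /=.
by case: eqP.
Qed.

Lemma char_sum_shift_le f g z : (0 < d)%N ->
    (forall i, additive_in f i) -> (forall i, additive_in g i) ->
  `|\sum_x chi (f x + g (x + z))| <= \sum_x chi (f x + g x).
Proof.
move=> d_gt0 fD gD.
have drop0 : drop_coords 0 z = z by apply/ffunP=> j; rewrite ffunE.
have dropd : drop_coords d z = 0.
  by apply/ffunP=> j; rewrite !ffunE leqNgt ltn_ord.
suff le_k k : (k <= d)%N -> `|\sum_x chi (f x + g (x + z))|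
    <= `|\sum_x chi (f x + g (x + drop_coords k z))|.
  have := le_k d (leqnn d); rewrite dropd; under [in X in _ <= X]eq_bigr do rewrite addr0.
  rewrite [X in _ <= X]ger0_norm //.
  exact: (char_sum_additive_ge0 (f \+ g) (Ordinal d_gt0) (additive_inD _ _ _ (fD _) (gD _))).
elim: k => [_|k IHk ltkd]; first by rewrite drop0.
apply: le_trans (IHk (ltnW ltkd)) _.
have step := @char_sum_shift_step f g (Ordinal ltkd) z (fD _) (gD _).
(* The right side of [step] bounds a modulus, so it is nonnegative and equals its own modulus; this
   lets the steps chain. *)
by rewrite (ger0_norm (le_trans (normr_ge0 _) step)).
Qed.

Lemma char_sum_mul_le f g : (0 < d)%N ->
    (forall i, additive_in f i) -> (forall i, additive_in g i) ->
  (\sum_x chi (f x)) * (\sum_x chi (g x))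
    <= #|{ffun 'I_d -> V}|%:R * \sum_x chi (f x + g x).
Proof.
move=> d_gt0 fD gD; pose i0 := Ordinal d_gt0.
have prod_ge0 := mulr_ge0 (char_sum_additive_ge0 _ _ (fD i0))
                          (char_sum_additive_ge0 _ _ (gD i0)).
(* The product equals its modulus, so the triangle inequality over the shifts [z] applies. *)
rewrite -(ger0_norm prod_ge0) mulr_suml.
have -> : \sum_x chi (f x) * (\sum_y chi (g y))
        = \sum_z \sum_x chi (f x + g (x + z)).
  rewrite exchange_big; apply: eq_bigr => x _; rewrite mulr_sumr /=.
  rewrite (reindex_inj (addrI x)); apply: eq_bigr => z _ /=.
  by rewrite chiD.
apply: le_trans (ler_norm_sum _ _ _) _; rewrite mulr_natl -sumr_const.
by apply: ler_sum => z _; apply: char_sum_shift_le.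
Qed.

End CharacterSums.

Section Bias.

Context {F : finFieldType} {R : realType} (chi : F -> R[i]).
Hypothesis chi_char : additive_character chi.
Context {V : vectType F} {d : nat}.
Hypothesis d_gt0 : (0 < d)%N.
Implicit Types T S : (finvect_type V ^ d)%type -> F.

Lemma multilinear_additive_in T (i : 'I_d) : multilinear T -> additive_in T i.
Proof.
by move=> Tlin x a b; have := Tlin i x 1 a b; rewrite /= scale1r mul1r.
Qed.

Lemma bias_ge0 T : multilinear T -> 0 <= bias chi T.
Proof.
move=> Tlin; have [chi0 chiD] := chi_char.
rewrite divr_ge0 ?ler0n //.
exact: (char_sum_additive_ge0 chi chi0 chiD _ (Ordinal d_gt0)
          (multilinear_additive_in _ _ Tlin)).
Qed.

Lemma bias_mul_le T S : multilinear T -> multilinear S ->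
  bias chi T * bias chi S <= bias chi (T \+ S).
Proof.
move=> Tlin Slin; have [chi0 chiD] := chi_char; rewrite /bias.
set N := #|_|%:R; have N_gt0 : 0 < N :> R[i].
  by rewrite ltr0n; apply/card_gt0P; exists 0.
rewrite mulrACA mulrA ler_pM2r ?invr_gt0 // ler_pdivrMr // [X in _ <= X]mulrC.
apply: (char_sum_mul_le chi chi0 chiD _ _ d_gt0) => i;
  exact: multilinear_additive_in.
Qed.

End Bias.

Theorem theorem1p5 (F : finFieldType) (R : realType) (chi : F -> R[i])
    (V : vectType F) (d : nat) (T S : (finvect_type V ^ d)%type -> F) :
  additive_character chi -> nontrivial_character chi ->
  (1 <= d)%N ->
  multilinear T -> multilinear S ->
  (arank chi (T \+ S)%R <= arank chi T + arank chi S)%E.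
Proof.
move=> chi_char _ d_gt0 Tlin Slin; rewrite /arank.
have biasM := bias_mul_le chi chi_char d_gt0 _ _ Tlin Slin.
have [_|T_neq0] := eqVneq (bias chi T) 0.
  (* The sum is [+oo] because the rank of [S] is never [-oo]. *)
  by rewrite addye ?leey //; case: ifP.
have [_|S_neq0] := eqVneq (bias chi S) 0; first by rewrite addey ?leey.
have T_gt0 : 0 < bias chi T by rewrite lt0r T_neq0 bias_ge0.
have S_gt0 : 0 < bias chi S by rewrite lt0r S_neq0 bias_ge0.
have TS_gt0 := lt_le_trans (mulr_gt0 T_gt0 S_gt0) biasM.
rewrite gt_eqF //.
move: T_gt0 S_gt0 TS_gt0 biasM.
(* The order on [R[i]] compares only numbers with equal imaginary parts, so positivity makes all
   three biases real and [biasM] becomes [a * b <= c]. *)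
case: (bias chi T) (bias chi S) (bias chi (T \+ S)) => [a a'] [b b'] [c c'].
rewrite !ltcE /= => /andP[/eqP-> a_gt0] /andP[/eqP-> b_gt0] /andP[/eqP-> c_gt0].
rewrite lecE /= !mulr0 subr0 => /andP[_ ab_le].
have lnF_gt0 : 0 < ln (#|F|%:R : R) by rewrite ln_gt0 // ltr1n finNzRing_gt1.
rewrite lee_fin -opprD lerN2 -mulrDl ler_pM2r ?invr_gt0 // -lnM ?posrE //.
by rewrite ler_ln ?posrE ?mulr_gt0.
Qed.
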